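(* Let $r\in\mathbb{N}$, $n\in\mathbb{N}_0$, $x\in\mathbb{C}$, and $\lambda\in\mathbb{C}$ with $|\lambda|<1$. Then $$\Phi^{E,r}_{M,\lambda}(-n,x)=\frac{1}{2^r}E^{(r)}_{n,M}(x;\lambda),$$ where $E^{(r)}_{n,M}(x;\lambda)$ denotes the Apostol-Mersenne-Euler polynomial of order $r$.
   Context: $\mathbb{N}=\{1,2,\ldots\}$, $\mathbb{N}_0=\{0,1,2,\ldots\}$. For $n\ge 0$, $M_n=2^n-1$. The M-factorial is $M_0!=1$ and $M_n!=M_nM_{n-1}\cdots M_1$ for $n\geq 1$. The M-exponential is $e_M^{xt}=\sum_{n=0}^{\infty}\frac{x^nt^n}{M_n!}$, and $e_M^t$ denotes the case $x=1$. For $m\in\mathbb{N}_0$ the Mersenne translation polynomials $P_{n,M}(x;m)$ are defined by $e_M^{xt}\left(e_M^t\right)^m=\sum_{n=0}^{\infty}P_{n,M}(x;m)\frac{t^n}{M_n!}$, where $(e_M^t)^m$ is the ordinary $m$-fold product. For $r\in\mathbb{N}$, $n\in\mathbb{N}_0$, $x\in\mathbb{C}$ and $|\lambda|<1$, the Euler-type Mersenne-Lerch interpolation value of order $r$ at $-n$ is the (convergent) series $\Phi^{E,r}_{M,\lambda}(-n,x)=\sum_{m=0}^{\infty}(-1)^m\binom{m+r-1}{m}\lambda^mP_{n,M}(x;m)$, where $\binom{m+r-1}{m}$ is the ordinary binomial coefficient and $\lambda^0=1$. The Apostol-Mersenne-Euler polynomials of order $r$ are defined by the power series expansion in $t$ (at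 $t=0$) $\left(\frac{2}{\lambda e_M^t+1}\right)^r e_M^{xt}=\sum_{n=0}^{\infty}E^{(r)}_{n,M}(x;\lambda)\frac{t^n}{M_n!}$. *)

(* Defs.v *)
From mathcomp Require Import all_boot all_order all_algebra.
From mathcomp Require Import all_classical all_reals all_analysis.
From mathcomp Require Export complex.

Set Implicit Arguments.
Unset Strict Implicit.
Unset Printing Implicit Defensive.

Import Order.TTheory GRing.Theory Num.Theory.
Import numFieldNormedType.Exports.

Local Open Scope classical_set_scope.
Local Open Scope ring_scope.

Definition mersenne (n : nat) : nat := (2 ^ n - 1)%N.

Definition mersenne_fact (n : nat) : nat :=
  (\prod_(1 <= k < n.+1) mersenne k)%N.

(* [K] is instantiated with [R[i]^o]: the complex numbers with the topology
   given by the modulus. *)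
Section MersenneLerch.
Variable K : numFieldType.

Definition mersenne_term (a : nat -> K) (t : K) (n : nat) : K :=
  a n * t ^+ n / (mersenne_fact n)%:R.

(* e_M^z; the series converges for every z. *)
Definition mersenne_exp (z : K) : K :=
  limn (series (mersenne_term (fun=> 1) z)).

(* f(t) = \sum_n a_n t^n / M_n!  as convergent series, for all t in some
   neighbourhood of 0. *)
Definition has_mersenne_expansion (f : K -> K) (a : nat -> K) : Prop :=
  \forall t \near (0 : K), series (mersenne_term a t) n @[n --> \oo] --> f t.

(* [get] selects a sequence satisfying the predicate. By uniqueness of power
   series coefficients at most one sequence does; both functions expanded
   below are analytic at 0 when lambda <> -1. *)
Definition mersenne_coef (f : K -> K) : nat -> K :=
  get [set a | has_mersenne_expansion f a].

(* P_{n,M}(x; m) *)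
Definition mersenne_translation (n : nat) (x : K) (m : nat) : K :=
  mersenne_coef (fun t => mersenne_exp (x * t) * mersenne_exp t ^+ m) n.

(* E^{(r)}_{n,M}(x; lambda) *)
Definition apostol_mersenne_euler (r n : nat) (x lambda : K) : K :=
  mersenne_coef (fun t =>
    (2 / (lambda * mersenne_exp t + 1)) ^+ r * mersenne_exp (x * t)) n.

Definition lerch_euler_term (r : nat) (lambda : K) (n : nat) (x : K)
    (m : nat) : K :=
  (-1) ^+ m * 'C(m + r - 1, m)%:R * lambda ^+ m * mersenne_translation n x m.

(* Phi^{E,r}_{M,lambda}(-n, x) *)
Definition lerch_euler (r : nat) (lambda : K) (n : nat) (x : K) : K :=
  limn (series (lerch_euler_term r lambda n x)).

End MersenneLerch.

(* Main.v *)
Require Import Defs.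
From mathcomp Require Import all_boot all_order all_algebra.
From mathcomp Require Import all_classical all_reals all_analysis.
From mathcomp Require Import ring lra.
Import Order.TTheory GRing.Theory Num.Theory.
Import numFieldNormedType.Exports.
Local Open Scope classical_set_scope.
Local Open Scope ring_scope.
Local Open Scope complex_scope.

Set Implicit Arguments.
Unset Strict Implicit.
Unset Printing Implicit Defensive.

(** The identity is the negative binomial series
      (1 + lambda y)^-r = \sum_m C(m+r-1, m) (- lambda y)^m
    at y = e_M^t, multiplied by e_M^(xt) and read coefficient by coefficient
    in t: the coefficient of t^n on the left is E^(r)_n(x; lambda) / (2^r M_n!),
    and the m-th summand contributes P_n(x; m) / M_n! times its weight. What
    has to be justified is that the coefficients of the partial sums converge
    to the coefficient of the closed form.

    Write mu = - lambda, f = e_M, g = e_M^(x .), and S_r^N for the sum of the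
    first N+1 terms of the series of order r times g. Pascal's rule telescopes
    (lemma [binomial_partial_sum]):
      (1 - mu f) S_(r+1)^N = S_r^N - C(N+r, N) mu^(N+1) f^(N+1) g.
    Divide by 1 - mu f, which is invertible near 0 since its value there is
    1 + lambda != 0, and compare coefficients: those of S_(r+1)^N are the
    Cauchy product of a fixed sequence with those of the right-hand side, hence
    finite combinations of them. So, by induction on r, they converge as soon
    as the boundary term tends to 0 coefficientwise. It does
    ([cvg_boundary]): as the coefficients of f are at most 1 in modulus, the
    n-th coefficient of f^N g is O(N^n), the binomial coefficient is at most
    (N+1)^r, and |mu|^N beats every power of N.

    All functions here are germs at 0 given by convergent power series, so the
    argument rests on a small calculus of such expansions: coefficients are
    unique ([expands_coef]), products expand by Cauchy products ([expandsM]),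
    and a germ with nonzero constant coefficient has an expandable inverse
    ([expandsV]). Each of these follows from geometric bounds on the
    coefficients. *)

(** The field of complex numbers, with the topology given by the modulus. *)
Local Notation C R := (complex_complex__canonical__Num_NumField R)
  (only parsing).

(** * The modulus as a real number *)

(** The norm of a complex number lives in the complex field; as an element of R
    it is accessible to the order-complete and archimedean theory. *)
Definition modulus (R : realType) (z : C R) : R := ComplexField.Normc.normc z.

Section Modulus.
Variable R : realType.
Implicit Types z w : C R.

Lemma ltr0_complex (a : R) : (0 < (a%:C : C R)) = (0 < a).
Proof. by rewrite -ltcR. Qed.

Lemma modulusE z : `|z| = (modulus z)%:C :> R[i].
Proof. by []. Qed.

Lemma modulus_ge0 z : 0 <= modulus z.
Proof. by rewrite -ler0c -modulusE normr_ge0. Qed.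

Lemma modulus0 : modulus (0 : C R) = 0.
Proof. exact: ComplexField.Normc.normc0. Qed.

Lemma modulus1 : modulus (1 : C R) = 1.
Proof. exact: ComplexField.Normc.normc1. Qed.

Lemma modulusM z w : modulus (z * w) = modulus z * modulus w.
Proof. exact: ComplexField.Normc.normcM. Qed.

Lemma modulusV z : modulus z^-1 = (modulus z)^-1.
Proof. exact: ComplexField.Normc.normcV. Qed.

Lemma modulusD z w : modulus (z + w) <= modulus z + modulus w.
Proof. by rewrite -lecR raddfD/= -!modulusE ler_normD. Qed.

Lemma modulusN z : modulus (- z) = modulus z.
Proof. by apply: complexI; rewrite -!modulusE normrN. Qed.

Lemma modulusX z n : modulus (z ^+ n) = modulus z ^+ n.
Proof. by apply: complexI; rewrite rmorphXn/= -!modulusE normrX. Qed.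

Lemma modulus_nat n : modulus (n%:R : C R) = n%:R.
Proof. by apply: complexI; rewrite rmorph_nat -!modulusE normr_nat. Qed.

Lemma modulus_real (a : R) : 0 <= a -> modulus (a%:C : C R) = a.
Proof. by move=> a0; apply: complexI; rewrite -!modulusE ger0_norm // ler0c. Qed.

Lemma modulus_eq0 z : (modulus z == 0) = (z == 0).
Proof. by rewrite -(inj_eq (@complexI R)) -modulusE normr_eq0. Qed.

Lemma modulus_sum I (s : seq I) (P : pred I) (F : I -> C R) :
  modulus (\sum_(i <- s | P i) F i) <= \sum_(i <- s | P i) modulus (F i).
Proof.
elim/big_rec2: _ => [|i y1 y2 _ h]; first by rewrite modulus0.
by rewrite (le_trans (modulusD _ _)) ?lerD2l.
Qed.

Lemma cvg_modulusP (u : nat -> C R) (l : C R) :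
  u @ \oo --> l <-> modulus (u n - l) @[n --> \oo] --> (0 : R).
Proof.
split.
  move=> /cvgrPdist_lt h; apply/cvgr0Pnorm_lt => e e0.
  have := h e%:C; rewrite ltr0_complex => /(_ e0); apply: filterS => n.
  by rewrite modulusE -modulusN opprB ltcR ger0_norm// modulus_ge0.
move=> /cvgr0Pnorm_lt h; apply/cvgrPdist_lt => e e0.
have [e' ee'] : exists e' : R, e = e'%:C.
  by exists (complex.Re e); rewrite RRe_real// gtr0_real.
move: e0; rewrite ee' ltr0_complex => e0.
apply: filterS (h _ e0) => n.
by rewrite modulusE -[in X in _ -> X]modulusN opprB ltcR ger0_norm// modulus_ge0.
Qed.

Lemma near0_modulusP (P : C R -> Prop) :
  (\forall t \near (0 : C R), P t) <->
  exists2 d : R, 0 < d & forall t, modulus t < d -> P t.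
Proof.
split.
  move=> /nbhs_ballP[e /= e0 h].
  have [e' ee'] : exists e' : R, e = e'%:C.
    by exists (complex.Re e); rewrite RRe_real// gtr0_real.
  exists e'; first by rewrite -ltr0_complex -ee'.
  move=> t te; apply: h; rewrite /ball/= /ball_ sub0r normrN modulusE ee' ltcR//.
move=> [d d0 h]; apply/nbhs_ballP; exists d%:C; rewrite /= ?ltr0_complex//.
move=> t; rewrite /ball/= /ball_ sub0r normrN modulusE ltcR => td; exact: h.
Qed.

Lemma modulus_Re z : `|complex.Re z| <= modulus z.
Proof. by rewrite -lecR -modulusE normc_ge_Re. Qed.

Lemma modulus_Im z : `|complex.Im z| <= modulus z.
Proof.
case: z => a b; rewrite /modulus/= -sqrtr_sqr ler_sqrt ?addr_ge0 ?sqr_ge0//.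
by rewrite lerDr sqr_ge0.
Qed.

Lemma modulus_le (a b : R) : modulus (a +i* b : C R) <= `|a| + `|b|.
Proof.
have -> : a +i* b = a%:C + 0 +i* b.
   by apply/eqP; rewrite eq_complex/= addr0 add0r !eqxx.
apply: le_trans (modulusD _ _) _.
by rewrite /modulus/= !expr0n/= addr0 add0r !sqrtr_sqr.
Qed.
End Modulus.

(** * Geometric decay *)

Section Geometric.
Variable R : realType.
Implicit Types (q A : R).

Lemma squeeze_cvg0 (u v : nat -> R) : (forall n, 0 <= u n <= v n) ->
  v @ \oo --> (0 : R) -> u @ \oo --> (0 : R).
Proof.
move=> uv v0; apply: (@squeeze_cvgr _ _ _ _ (cst 0) v) => //.
  by apply: nearW.
exact: cvg_cst.
Qed.

Lemma geometric_sum_le q n : 0 <= q < 1 -> \sum_(i < n) q ^+ i <= (1 - q)^-1.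
Proof.
move=> /andP[q0 q1]; have q1' : 0 < 1 - q by rewrite subr_gt0.
rewrite -(ler_pM2l q1') mulfV ?gt_eqF// -opprB mulNr -subrX1 opprB.
by rewrite gerBl exprn_ge0.
Qed.

(** q^n is at most each of the n+1 first terms of the geometric series. *)
Lemma linear_geometric_le q n : 0 <= q < 1 -> n.+1%:R * q ^+ n <= (1 - q)^-1.
Proof.
move=> q01; apply: le_trans (geometric_sum_le n.+1 q01).
have -> : n.+1%:R * q ^+ n = \sum_(i < n.+1) q ^+ n.
  by rewrite sumr_const card_ord -[RHS]mulr_natl.
move: q01 => /andP[q0 q1]; apply: ler_sum => i _.
by apply: ler_wiXn2l => //; [exact: ltW | rewrite -ltnS].
Qed.

(** With s the square root of q, n^(k+1) q^n = (n s^n) (n^k s^n): the first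
    factor is bounded and the second tends to 0 by induction on k. *)
Lemma cvg_poly_geometric k q : 0 <= q < 1 ->
  (n.+1%:R ^+ k * q ^+ n) @[n --> \oo] --> (0 : R).
Proof.
elim: k q => [|k IH] q q01.
  under eq_fun do rewrite expr0 mul1r.
  by move: q01 => /andP[q0 q1]; apply: cvg_expr; rewrite ger0_norm.
have s01 : 0 <= Num.sqrt q < 1.
  rewrite sqrtr_ge0/= -[ltRHS]sqrtr1 ltr_sqrt//.
  by case/andP: q01.
have q0 : 0 <= q by case/andP: q01.
set s := Num.sqrt q in s01.
apply: (@squeeze_cvg0 _ (fun n => (1 - s)^-1 * (n.+1%:R ^+ k * s ^+ n))).
  move=> n; rewrite mulr_ge0 ?exprn_ge0//=.
  have -> : n.+1%:R ^+ k.+1 * q ^+ n =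
      (n.+1%:R * s ^+ n) * (n.+1%:R ^+ k * s ^+ n).
    by rewrite -(sqr_sqrtr q0) -/s -exprM mul2n -addnn exprD exprS; ring.
  apply: ler_wpM2r; last exact: linear_geometric_le.
  by case/andP: s01 => s0 _; rewrite mulr_ge0 ?exprn_ge0.
rewrite -[X in _ --> X](mulr0 (1 - s)^-1); apply: cvgMl_tmp.
exact: IH.
Qed.

(** The real and imaginary parts converge absolutely in R, which is complete. *)
Lemma cvg_geometric_bound (u : nat -> C R) A q : 0 <= q < 1 ->
  (forall n, modulus (u n) <= A * q ^+ n) -> cvgn (series u).
Proof.
move=> /andP[q0 q1] uA.
have cq (v : nat -> R) : (forall n, `|v n| <= modulus (u n)) -> cvgn (series v).
  move=> vu; apply: (@normed_cvg R R^o).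
  apply: (@series_le_cvg _ _ (geometric A q)) => //=.
  - by move=> n; rewrite (le_trans _ (uA n)) ?modulus_ge0.
  - by move=> n; rewrite (le_trans (vu n)).
  - by apply: is_cvg_geometric_series; rewrite ger0_norm.
have /cvg_ex[a /= ha] := cq _ (fun n => modulus_Re (u n)).
have /cvg_ex[b /= hb] := cq _ (fun n => modulus_Im (u n)).
suff ul : series u @ \oo --> (a +i* b : C R) by exact: cvgP ul.
apply/cvg_modulusP.
have series_split n : series u n =
    series (fun m => complex.Re (u m)) n +i* series (fun m => complex.Im (u m)) n.
  rewrite /series/=; elim: n => [|n IHn]; first by rewrite !big_geq.
  by rewrite !big_nat_recr//= IHn; case: (u n).
have cv0 (v : nat -> R) (c : R) : v @ \oo --> c -> `|v n - c| @[n --> \oo] --> (0 : R).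
  move=> vc; rewrite -[X in _ --> X](normr0 R) -[X in `|X|](subrr c).
  by apply: cvg_norm; apply: cvgB => //; exact: cvg_cst.
have := cvgD (cv0 _ _ ha) (cv0 _ _ hb); rewrite addr0 => h.
apply: (squeeze_cvg0 _ (h _)) => n; rewrite modulus_ge0/= series_split.
exact: modulus_le.
Qed.
End Geometric.

(** * Germs given by convergent power series *)

Section Expansions.
Variable R : realType.
Implicit Types (f g : C R -> C R) (a b c : nat -> C R) (t z : C R).

(** Ordinary coefficients are used throughout, without the factors 1 / M_n!, so
    that products of functions give Cauchy products of sequences. *)
Definition power_series b t : nat -> C R := series (fun n => b n * t ^+ n).

Definition expands f b :=
  \forall t \near (0 : C R), power_series b t @ \oo --> f t.

Definition geometric_bounded b :=
  exists A D : R, 0 < D /\ forall n, modulus (b n) <= A * D ^+ n.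

Lemma near0W (P : C R -> Prop) : (forall t, P t) -> \forall t \near (0 : C R), P t.
Proof. by move=> Pt; apply/near0_modulusP; exists 1. Qed.

Lemma near0S (P Q : C R -> Prop) : (forall t, P t -> Q t) ->
  (\forall t \near (0 : C R), P t) -> \forall t \near (0 : C R), Q t.
Proof.
move=> PQ /near0_modulusP[d d0 Pd].
by apply/near0_modulusP; exists d => // t /Pd/PQ.
Qed.

Lemma near0I (P Q : C R -> Prop) : (\forall t \near (0 : C R), P t) ->
  (\forall t \near (0 : C R), Q t) -> \forall t \near (0 : C R), P t /\ Q t.
Proof.
move=> /near0_modulusP[d d0 Pd] /near0_modulusP[e e0 Qe].
apply/near0_modulusP; exists (Num.min d e); first by rewrite lt_min d0.
by move=> t; rewrite lt_min => /andP[/Pd ? /Qe].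
Qed.

Lemma near0S2 (P Q S : C R -> Prop) : (forall t, P t -> Q t -> S t) ->
  (\forall t \near (0 : C R), P t) -> (\forall t \near (0 : C R), Q t) ->
  \forall t \near (0 : C R), S t.
Proof. by move=> PQS P0 Q0; apply: near0S (near0I P0 Q0) => t []; exact: PQS. Qed.

Lemma cvgD_complex (u v : nat -> C R) (l m : C R) :
  u @ \oo --> l -> v @ \oo --> m -> (fun n => u n + v n) @ \oo --> (l + m : C R).
Proof. by move=> ul vm; apply: (@cvgD _ _ _ _ _ u v); [exact: ul|exact: vm]. Qed.

Lemma cvgZ_complex (k : C R) (u : nat -> C R) (l : C R) :
  u @ \oo --> l -> (fun n => k * u n) @ \oo --> (k * l : C R).
Proof. by move=> ul; apply: cvgMl_tmp; exact: ul. Qed.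

Lemma le_cvgn_lim (x : R) (v : nat -> R) l :
  (forall n, x <= v n) -> v @ \oo --> l -> x <= l.
Proof.
move=> xv vl; rewrite -(cvg_lim _ vl)//; apply: limr_ge; first exact: cvgP vl.
exact: nearW.
Qed.

Lemma cvg_series_modulus_bounded (u : nat -> C R) (l : C R) :
  series u @ \oo --> l -> exists A, forall n, modulus (u n) <= A.
Proof.
move=> ul; have u0 : u @ \oo --> (0 : C R).
  by apply: cvg_series_cvg_0; exact: cvgP ul.
have : (fun n => modulus (u n)) @ \oo --> (0 : R).
  by move/cvg_modulusP: u0; under eq_fun do rewrite subr0.
move=> /cvgP/cvg_seq_bounded/bounded_fun_has_ubound[A uA].
by exists A => n; apply: uA; exists n.
Qed.

(** Convergence at a single nonzero point d/2 bounds the terms there, which is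
    a geometric bound on the coefficients. *)
Lemma expands_bounded f b : expands f b -> geometric_bounded b.
Proof.
move=> /near0_modulusP[d d0 fb].
pose t : C R := (d / 2)%:C.
have mt : modulus t = d / 2 by rewrite modulus_real// divr_ge0 ?ltW.
have [A bA] : exists A, forall n, modulus (b n * t ^+ n) <= A.
  by apply: (cvg_series_modulus_bounded (fb t _)); rewrite mt; lra.
exists A, (d / 2)^-1; split; first by rewrite invr_gt0 divr_gt0.
move=> n; rewrite exprVn ler_pdivlMr ?exprn_gt0 ?divr_gt0//.
by have := bA n; rewrite modulusM modulusX mt.
Qed.

Lemma geometric_bound_ge0 b (A D : R) :
  (forall n, modulus (b n) <= A * D ^+ n) -> 0 <= A.
Proof. by move/(_ 0%N); rewrite expr0 mulr1; apply: le_trans; exact: modulus_ge0. Qed.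

(** The ratio 1/2 is the same for all germs: only the neighbourhood depends on
    the radius of convergence, so that two germs can be compared near 0. *)
Lemma near0_terms_le_half b : geometric_bounded b -> exists A,
  \forall t \near (0 : C R), forall n, modulus (b n * t ^+ n) <= A * 2^-1 ^+ n.
Proof.
move=> [A [D [D0 bA]]]; exists A; apply/near0_modulusP.
exists (2 * D)^-1; first by rewrite invr_gt0 mulr_gt0.
move=> t tD n; rewrite modulusM modulusX.
have Dt : D * modulus t <= 2^-1.
  move: tD; rewrite invfM -ltr_pdivrMr ?invr_gt0// invrK mulrC => /ltW; lra.
apply: le_trans (_ : A * D ^+ n * modulus t ^+ n <= _).
  by rewrite ler_wpM2r// exprn_ge0 ?modulus_ge0.
rewrite -mulrA -exprMn ler_wpM2l ?(geometric_bound_ge0 bA)//.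
by apply: lerXn2r => //; rewrite nnegrE ?mulr_ge0 ?modulus_ge0// ltW.
Qed.

Lemma half_itv01 : 0 <= (2^-1 : R) < 1.
Proof. by rewrite invr_ge0 ler0n/= invf_lt1// ltr1n. Qed.

Lemma bounded_expands b : geometric_bounded b ->
  expands (fun t => limn (power_series b t)) b.
Proof.
move=> /near0_terms_le_half[A]; apply: near0S => t bA.
exact: (cvg_geometric_bound half_itv01 bA).
Qed.

Lemma expands_eq f g b : expands f b -> (\forall t \near (0 : C R), f t = g t) ->
  expands g b.
Proof. by move=> fb fg; apply: near0S2 fb fg => t + <-. Qed.

(** The value of the sum at 0 is not known, so the constant coefficient is
    reached by continuity: at the point q s, for a fixed s, the terms after the
    constant one add up to at most 2 A q, and q is arbitrarily small. *)
Lemma constant_coef0 b : geometric_bounded b ->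
  (\forall t \near (0 : C R), t != 0 -> power_series b t @ \oo --> (0 : C R)) ->
  b 0%N = 0.
Proof.
move=> /near0_terms_le_half[A bA] b0.
have [d d0 H] := (near0_modulusP _).1 (near0I bA b0).
have A0 : 0 <= A.
  have := (H 0 _).1 0%N; rewrite modulus0 => /(_ d0).
  by rewrite !expr0 !mulr1; apply: le_trans; exact: modulus_ge0.
pose s : C R := (d / 2)%:C.
have ms : modulus s = d / 2 by rewrite modulus_real// divr_ge0 ?ltW.
have sA n : modulus (b n) * modulus s ^+ n <= A.
  have sd : modulus s < d by rewrite ms; lra.
  rewrite -modulusX -modulusM (le_trans ((H s sd).1 n))// ler_piMr//.
  by case/andP: half_itv01 => h0 h1; apply: exprn_ile1 => //; exact: ltW.
have bq (q : R) : 0 < q <= 2^-1 -> modulus (b 0%N) <= 2 * A * q.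
  move=> /andP[q0 q1]; pose t := q%:C * s.
  have mt : modulus t = q * modulus s by rewrite modulusM modulus_real ?ltW.
  have td : modulus t < d by rewrite mt ms; nra.
  have t0 : t != 0 by rewrite -modulus_eq0 mt ms; nra.
  have /cvg_modulusP := (H t td).2 t0.
  under eq_fun do rewrite subr0.
  rewrite -cvg_shiftS => v0.
  rewrite -subr_le0; apply: le_cvgn_lim v0 => n.
  rewrite lerBlDr /power_series/series/= big_nat_recl// expr0 mulr1.
  set T := \sum_(0 <= i < n) _.
  have -> : modulus (b 0%N) = modulus (b 0%N + T - T) by rewrite addrK.
  apply: le_trans (modulusD _ _) _; rewrite lerD2l modulusN.
  apply: le_trans (modulus_sum _ _ _) _; rewrite big_mkord.
  apply: le_trans (_ : \sum_(i < n) A * q * q ^+ i <= _).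
    apply: ler_sum => i _; rewrite modulusM modulusX mt exprMn mulrCA mulrC.
    by rewrite -[leRHS]mulrA -exprS ler_wpM2r// exprn_ge0// ltW.
  rewrite -mulr_sumr (_ : 2 * A * q = A * q * 2); last by ring.
  rewrite ler_wpM2l ?mulr_ge0 ?(ltW q0)//.
  apply: le_trans (geometric_sum_le n (_ : 0 <= q < 1)) _.
    by apply/andP; split; lra.
  by rewrite -[leRHS]invrK lef_pV2 ?posrE//; lra.
apply/eqP; rewrite -modulus_eq0 eq_le modulus_ge0 andbT leNgt; apply/negP => m0.
have dn0 : 0 < 4 * A + 2 * modulus (b 0%N) by lra.
(* This q is at most 1/2 and makes 2 A q smaller than the modulus of b 0. *)
have := bq (modulus (b 0%N) / (4 * A + 2 * modulus (b 0%N))).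
rewrite divr_gt0//= ler_pdivrMr// => /(_ _)/wrap[]; first by lra.
rewrite mulrA ler_pdivlMr//; nra.
Qed.

(** Once the constant coefficient vanishes, division by t shifts the sequence;
    the induction runs over punctured neighbourhoods because of this division. *)
Lemma expands0_coef b : expands (fun=> 0) b -> b = (fun=> 0).
Proof.
move=> b0; apply/funext => n.
have gb := expands_bounded b0.
have {b0} : \forall t \near (0 : C R), t != 0 -> power_series b t @ \oo --> (0 : C R).
  by apply: near0S b0.
elim: n b gb => [|n IH] b gb b0; first exact: constant_coef0.
apply: (IH (fun k => b k.+1)).
  case: gb => A [D [D0 bA]]; exists (A * D), D; split=> // k.
  by rewrite -mulrA -exprS.
have c0 := constant_coef0 gb b0.
apply: near0S b0 => t bt t0; have {}bt := bt t0.
have -> : power_series (fun k => b k.+1) t = (fun k => t^-1 * power_series b t k.+1).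
  apply/funext => k; rewrite /power_series/series/= big_nat_recl// c0 mul0r add0r.
  by rewrite mulr_sumr; apply: eq_bigr => i _; rewrite exprS mulrCA mulKf.
rewrite -[X in _ --> X](mulr0 t^-1); apply: cvgZ_complex.
by rewrite (cvg_shiftS (power_series b t)).
Qed.

Lemma expandsD f g a b : expands f a -> expands g b ->
  expands (fun t => f t + g t) (fun n => a n + b n).
Proof.
apply: near0S2 => t fa gb.
have -> : power_series (fun n => a n + b n) t =
    (fun n => power_series a t n + power_series b t n).
  apply/funext => n; rewrite /power_series/series/= -big_split.
  by apply: eq_bigr => i _; rewrite mulrDl.
exact (cvgD_complex fa gb).
Qed.

Lemma expandsZ z f b : expands f b -> expands (fun t => z * f t) (fun n => z * b n).
Proof.
apply: near0S => t fb.
have -> : power_series (fun n => z * b n) t = (fun n => z * power_series b t n).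
  apply/funext => n; rewrite /power_series/series/= mulr_sumr.
  by apply: eq_bigr => i _; rewrite mulrA.
exact (@cvgZ_complex z _ _ fb).
Qed.

Lemma expands_coef f a b : expands f a -> expands f b -> a = b.
Proof.
move=> fa fb; have /expands0_coef ab0 : expands (fun=> 0) (fun n => a n + -1 * b n).
  apply: expands_eq (expandsD fa (expandsZ (-1) fb)) _.
  by apply: near0W => t; rewrite mulN1r subrr.
apply/funext => n; apply/eqP.
by rewrite -subr_eq0 -[X in _ - X]mul1r -mulNr (congr1 (@^~ n) ab0).
Qed.
End Expansions.

(** * Products and inverses of expansions *)

Section Products.
Variable R : realType.
Implicit Types (f g : C R -> C R) (a b c : nat -> C R) (t z : C R).

Definition cauchy_product a b (n : nat) : C R := \sum_(i < n.+1) a i * b (n - i)%N.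

Lemma cauchy_partial_sum a b n :
  series (cauchy_product a b) n = \sum_(i < n) a i * series b (n - i)%N.
Proof.
elim: n => [|n IH]; first by rewrite /series/= big_geq// big_ord0.
have b1 : series b 1%N = b 0%N by rewrite /series/= big_nat1.
rewrite seriesSr IH [RHS]big_ord_recr/= subSnn b1.
rewrite /cauchy_product big_ord_recr/= subnn addrA -big_split/=; congr (_ + _).
by apply: eq_bigr => i _; rewrite subSn 1?ltnW// seriesSr mulrDr.
Qed.

(** By [cauchy_partial_sum] the difference is the sum over i < n of u_i times a
    tail of v of length i beginning at n - i, and each of these n terms is at
    most A B n 2^-n. *)
Lemma cauchy_tail_le (u v : nat -> C R) (A B : R) n :
  (forall k, modulus (u k) <= A * 2^-1 ^+ k) ->
  (forall k, modulus (v k) <= B * 2^-1 ^+ k) ->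
  modulus (series (cauchy_product u v) n - series u n * series v n) <=
    A * B * (n.+1%:R ^+ 2 * 2^-1 ^+ n).
Proof.
move=> uA vB.
have h0 k : 0 <= (2^-1 : R) ^+ k by rewrite exprn_ge0// invr_ge0.
have A0 : 0 <= A by have := uA 0%N; rewrite mulr1; apply: le_trans (modulus_ge0 _).
have B0 : 0 <= B by have := vB 0%N; rewrite mulr1; apply: le_trans (modulus_ge0 _).
have tail i : (i < n)%N ->
    modulus (series v (n - i)%N - series v n) <= n.+1%:R * B * 2^-1 ^+ (n - i).
  move=> lin; rewrite -modulusN opprB sub_series leq_subr.
  apply: le_trans (modulus_sum _ _ _) _.
  apply: le_trans (_ : \sum_(n - i <= k < n) B * 2^-1 ^+ (n - i) <= _).
    apply: ler_sum_nat => k /andP[ik kn]; apply: le_trans (vB k) _.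
    rewrite ler_wpM2l// ler_wiXn2l ?invr_ge0//.
    by rewrite invf_le1// ler1n.
  rewrite sumr_const_nat -[leLHS]mulr_natl -mulrA ler_wpM2r ?mulr_ge0//.
  by rewrite ler_nat subKn ltnW// ltnW.
rewrite cauchy_partial_sum.
have -> : series u n * series v n = \sum_(i < n) u i * series v n.
  by rewrite [series u n]/series/= big_mkord mulr_suml.
rewrite -sumrB; apply: le_trans (modulus_sum _ _ _) _.
apply: le_trans (_ : \sum_(i < n) A * B * n.+1%:R * 2^-1 ^+ n <= _).
  apply: ler_sum => i _; rewrite -mulrBr modulusM.
  have -> : A * B * n.+1%:R * 2^-1 ^+ n =
      (A * 2^-1 ^+ i) * (n.+1%:R * B * 2^-1 ^+ (n - i)).
    have -> : (2^-1 : R) ^+ n = 2^-1 ^+ i * 2^-1 ^+ (n - i).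
      by rewrite -exprD subnKC// ltnW.
    by ring.
  by apply: ler_pM (uA i) (tail i _); rewrite ?modulus_ge0.
rewrite sumr_const card_ord -[leLHS]mulr_natl.
have -> : A * B * (n.+1%:R ^+ 2 * 2^-1 ^+ n) =
  n.+1%:R * (A * B * n.+1%:R * 2^-1 ^+ n) by ring.
by rewrite ler_wpM2r ?mulr_ge0// ler_nat.
Qed.

(** Mertens' theorem in its easy case, where the terms of both series are
    dominated by the same geometric progression. *)
Lemma expandsM f g a b : expands f a -> expands g b ->
  expands (fun t => f t * g t) (cauchy_product a b).
Proof.
move=> fa gb.
have [A hA] := near0_terms_le_half (expands_bounded fa).
have [B hB] := near0_terms_le_half (expands_bounded gb).
have h := near0I (near0I fa gb) (near0I hA hB).
apply: near0S h => t [[fat gbt] [At Bt]].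
have -> : power_series (cauchy_product a b) t =
    series (cauchy_product (fun n => a n * t ^+ n) (fun n => b n * t ^+ n)).
  congr series; apply/funext => n; rewrite mulr_suml; apply: eq_bigr => i _.
  have -> : t ^+ n = t ^+ i * t ^+ (n - i) by rewrite -exprD subnKC// -ltnS.
  by rewrite mulrACA.
set u := (fun n => a n * t ^+ n); set v := (fun n => b n * t ^+ n).
have uvt : (fun n => series u n * series v n) @ \oo --> (f t * g t : C R).
  exact: cvgM fat gbt.
have d0 : (fun n => series (cauchy_product u v) n - series u n * series v n)
    @ \oo --> (0 : C R).
  apply/cvg_modulusP; under eq_fun do rewrite subr0.
  apply: (@squeeze_cvg0 _ _ (fun n => A * B * (n.+1%:R ^+ 2 * 2^-1 ^+ n))).
    by move=> n; rewrite modulus_ge0; apply: cauchy_tail_le.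
  rewrite -[X in _ --> X](mulr0 (A * B)); apply: cvgMl_tmp.
  exact: cvg_poly_geometric (half_itv01 R).
have := cvgD_complex d0 uvt; rewrite add0r.
by under eq_fun do rewrite subrK.
Qed.

Lemma expands_cst z : expands (fun=> z) (fun n => if n == 0%N then z else 0).
Proof.
apply: near0W => t; rewrite -(cvg_shiftS (power_series _ t)).
have -> : (fun n => power_series (fun n => if n == 0%N then z else 0) t n.+1) = (fun=> z).
  apply/funext => n; rewrite /power_series/series/= big_nat_recl//= expr0 mulr1.
  by rewrite big1 ?addr0// => i _; rewrite mul0r.
exact: cvg_cst.
Qed.

(** The whole prefix of the sequence is carried along, since each new
    coefficient depends on all the previous ones. *)
Fixpoint inverse_coefs a (n : nat) : seq (C R) :=
  if n is m.+1 then
    let s := inverse_coefs a m in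
    rcons s (- (a 0%N)^-1 * \sum_(i < m.+1) a i.+1 * nth 0 s (m - i))
  else [:: (a 0%N)^-1].

Definition inverse_coef a n := nth 0 (inverse_coefs a n) n.

Lemma size_inverse_coefs a n : size (inverse_coefs a n) = n.+1.
Proof. by elim: n => //= n IH; rewrite size_rcons IH. Qed.

Lemma nth_inverse_coefs a n i : (i <= n)%N ->
  nth 0 (inverse_coefs a n) i = inverse_coef a i.
Proof.
elim: n => [|n IH]; first by rewrite leqn0 => /eqP ->.
rewrite leq_eqVlt => /predU1P[->//|lin].
by rewrite /= nth_rcons size_inverse_coefs lin IH.
Qed.

Lemma inverse_coefS a n : inverse_coef a n.+1 =
  - (a 0%N)^-1 * \sum_(i < n.+1) a i.+1 * inverse_coef a (n - i).
Proof.
rewrite /inverse_coef/= nth_rcons size_inverse_coefs ltnn eqxx.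
by congr (_ * _); apply: eq_bigr => i _; rewrite nth_inverse_coefs// leq_subr.
Qed.

Lemma cauchy_inverse a : a 0%N != 0 ->
  cauchy_product a (inverse_coef a) = (fun n => if n == 0%N then 1 else 0).
Proof.
move=> a0; apply/funext => -[|n]; rewrite /cauchy_product.
  by rewrite big_ord1 /inverse_coef/= mulfV.
rewrite big_ord_recl/= inverse_coefS mulNr mulrN mulVKf// addrC; apply/eqP.
by rewrite subr_eq0; apply/eqP/eq_bigr => i _; rewrite /bump/= add1n subSS.
Qed.

(** With d = 1 / |a_0| and |a_k| <= A D^k, the recursion preserves the bound
    d E^n for E = D (1 + d A): this E is the one for which the geometric sum
    \sum_i D^i E^(n-i), multiplied by A d D = E - D, telescopes. *)
Lemma inverse_coef_bounded a : geometric_bounded a -> a 0%N != 0 ->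
  geometric_bounded (inverse_coef a).
Proof.
move=> [A [D [D0 aA]]] a0; have A0 := geometric_bound_ge0 aA.
pose d := (modulus (a 0%N))^-1.
have d0 : 0 < d by rewrite invr_gt0 lt_neqAle eq_sym modulus_eq0 a0 modulus_ge0.
pose E := D * (1 + d * A).
have E0 : 0 < E by rewrite mulr_gt0// ltr_wpDr// mulr_ge0// ltW.
exists d, E; split=> //.
have key n : modulus (inverse_coef a n) <= d * E ^+ n.
  elim/ltn_ind: n => -[|n] IH.
    by rewrite /inverse_coef/= modulusV expr0 mulr1.
  rewrite inverse_coefS modulusM modulusN modulusV -/d ler_wpM2l ?(ltW d0)//.
  apply: le_trans (modulus_sum _ _ _) _.
  apply: le_trans (_ : \sum_(i < n.+1) (A * d * D) * (D ^+ i * E ^+ (n - i)) <= _).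
    apply: ler_sum => i _; rewrite modulusM.
    apply: le_trans (_ : (A * D ^+ i.+1) * (d * E ^+ (n - i)) <= _).
      apply: ler_pM => //; rewrite ?modulus_ge0//.
      by apply: IH; rewrite ltnS leq_subr.
    by rewrite le_eqVlt; apply/orP; left; apply/eqP; rewrite exprS; ring.
  rewrite -mulr_sumr.
  have -> : A * d * D = E - D by rewrite /E; ring.
  have -> : \sum_(i < n.+1) D ^+ i * E ^+ (n - i) =
      \sum_(i < n.+1) E ^+ (n.+1.-1 - i) * D ^+ i.
    by apply: eq_bigr => i _; rewrite mulrC.
  by rewrite -subrXX gerBl exprn_ge0// ltW.
exact: key.
Qed.

(** The formal inverse converges near 0, and its product with f has the
    expansion of the constant 1. *)
Lemma expandsV f a : expands f a -> a 0%N != 0 ->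
  (\forall t \near (0 : C R), f t != 0) /\
  exists b, expands (fun t => (f t)^-1) b.
Proof.
move=> fa a0; have ga := expands_bounded fa.
have hb := bounded_expands (inverse_coef_bounded ga a0).
set h := (fun t => limn _) in hb.
have fh : \forall t \near (0 : C R), f t * h t = 1.
  have := expandsM fa hb; rewrite cauchy_inverse//.
  have := expands_cst 1; apply: near0S2 => t t1 tfh.
  exact: (cvg_unique _ tfh t1).
split.
  by apply: near0S fh => t /eqP; apply: contraTneq => ->; rewrite mul0r eq_sym oner_eq0.
exists (inverse_coef a); apply: expands_eq hb _.
apply: near0S fh => t ft; rewrite -[RHS]mulr1 -ft mulKf//.
by apply: contra_eq_neq ft => ->; rewrite mul0r eq_sym oner_eq0.
Qed.
End Products.

(** * The negative binomial series, coefficientwise *)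

Section NegativeBinomial.
Variable R : realType.
Implicit Types (f g : C R -> C R) (a b c : nat -> C R) (t z mu : C R).

Lemma cvg_sum_complex n (u : 'I_n -> nat -> C R) (l : 'I_n -> C R) :
  (forall i, u i @ \oo --> l i) ->
  (fun N => \sum_(i < n) u i N) @ \oo --> (\sum_(i < n) l i : C R).
Proof.
elim: n u l => [|n IH] u l ul.
  rewrite big_ord0; under eq_fun do rewrite big_ord0.
  exact: cvg_cst.
rewrite big_ord_recl; under eq_fun do rewrite big_ord_recl.
exact (cvgD_complex (ul ord0)
  (IH (fun i => u (lift ord0 i)) _ (fun i => ul (lift ord0 i)))).
Qed.

Lemma cvg_cauchy_product a (u : nat -> nat -> C R) (l : nat -> C R) n :
  (forall k, (fun N => u N k) @ \oo --> l k) ->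
  (fun N => cauchy_product a (u N) n) @ \oo --> cauchy_product a l n.
Proof.
move=> ul.
exact (cvg_sum_complex (fun i : 'I_n.+1 => @cvgZ_complex _ (a i) _ _ (ul (n - i)%N))).
Qed.

(** For r = 0 the truncated subtraction still gives the right series: the
    weight is 1 at m = 0 and C(m-1, m) = 0 afterwards. *)
Definition binomial_weight (r : nat) mu (m : nat) : C R :=
  'C(m + r - 1, m)%:R * mu ^+ m.

(** Pascal's rule makes the partial sums of order r+1 telescope to those of
    order r. *)
Lemma binomial_partial_sum (r N : nat) mu y z :
  (1 - mu * y) * \sum_(m < N.+1) binomial_weight r.+1 mu m * (y ^+ m * z) =
  \sum_(m < N.+1) binomial_weight r mu m * (y ^+ m * z) -
  'C(N + r, N)%:R * mu ^+ N.+1 * (y ^+ N.+1 * z).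
Proof.
elim: N => [|N IH].
  by rewrite !big_ord1 /binomial_weight !bin0 !expr0 !expr1; ring.
rewrite big_ord_recr/= mulrDr IH [in RHS]big_ord_recr/= -!addrA; congr (_ + _).
rewrite /binomial_weight addnS !subn1/= addSn binS natrD /=.
by rewrite [_ ^+ N.+2]exprS [y ^+ N.+2]exprS; ring.
Qed.

Lemma sum_expr_le (y : R) n : 0 <= y -> \sum_(k < n.+1) y ^+ k <= (y + 1) ^+ n.
Proof.
move=> y0; elim: n => [|n IH]; first by rewrite big_ord1 !expr0.
rewrite big_ord_recr/= [leRHS]exprS mulrDl mul1r addrC lerD//.
rewrite exprS ler_wpM2l// lerXn2r ?nnegrE ?addr_ge0// lerDl//.
Qed.

(** Polynomial growth in m of the coefficients of f^m g: multiplication by f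
    sums the previous bounds y^k, k <= n, with y = D (m+1), and this sum is at
    most (y + 1)^n. *)
Lemma iter_cauchy_le (D : R) a b m n : 1 <= D ->
  (forall k, modulus (a k) <= 1) -> (forall k, modulus (b k) <= D ^+ k) ->
  modulus (iter m (cauchy_product a) b n) <= (D * m.+1%:R) ^+ n.
Proof.
move=> D1 a1 bD; have D0 : 0 <= D by apply: le_trans D1.
elim: m n => [|m IH] n; first by rewrite mulr1.
rewrite /= /cauchy_product; apply: le_trans (modulus_sum _ _ _) _.
apply: le_trans (_ : \sum_(i < n.+1) (D * m.+1%:R) ^+ (n - i) <= _).
  apply: ler_sum => i _; rewrite modulusM -[leRHS]mul1r.
  by apply: ler_pM; rewrite ?modulus_ge0 ?a1 ?IH.
rewrite (reindex_inj rev_ord_inj)/=.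
under eq_bigr => i _ do rewrite subSS (subKn (leq_ord i)).
apply: le_trans (sum_expr_le _ _) _; first by rewrite mulr_ge0.
by rewrite lerXn2r ?nnegrE ?addr_ge0 ?mulr_ge0// [in leRHS]mulrSr mulrDr mulr1 lerD2l.
Qed.

(** C(N+r+1, N) = C(N+r, N) (N+r+1) / (r+1), and N+r+1 <= (r+1) (N+1). *)
Lemma bin_le_expn N r : ('C(N + r, N) <= N.+1 ^ r)%N.
Proof.
elim: r => [|r IH]; first by rewrite addn0 binn.
rewrite -bin_sub ?leq_addr// addKn addnS.
rewrite -(leq_pmul2l (ltn0Sn r)) -mul_bin_diag expnS mulnA leq_mul//.
  by rewrite mulSn -addSn leq_add2l leq_pmulr.
by rewrite -[X in (X <= _)%N]bin_sub ?leq_addl// addnK.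
Qed.

(** The boundary term of [binomial_partial_sum] is, coefficientwise, a
    polynomial in N times |mu|^N. *)
Lemma cvg_boundary (D : R) a b mu r n : 1 <= D ->
  (forall k, modulus (a k) <= 1) -> (forall k, modulus (b k) <= D ^+ k) ->
  modulus mu < 1 ->
  (fun N => 'C(N + r, N)%:R * mu ^+ N.+1 * iter N.+1 (cauchy_product a) b n)
    @ \oo --> (0 : C R).
Proof.
move=> D1 a1 bD mu1; have D0 : 0 <= D by apply: le_trans D1.
apply/cvg_modulusP; under eq_fun do rewrite subr0.
apply: (@squeeze_cvg0 _ _ (fun N =>
    (D * 2) ^+ n * (N.+1%:R ^+ (r + n) * modulus mu ^+ N))).
  move=> N; rewrite modulus_ge0 !modulusM modulus_nat modulusX/=.
  have h1 : 'C(N + r, N)%:R <= N.+1%:R ^+ r :> R.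
    by rewrite -natrX ler_nat bin_le_expn.
  have h2 : modulus mu ^+ N.+1 <= modulus mu ^+ N.
    by rewrite exprS ler_piMl ?exprn_ge0 ?modulus_ge0 ?ltW.
  have h3 : modulus (iter N.+1 (cauchy_product a) b n) <= (D * 2 * N.+1%:R) ^+ n.
    apply: le_trans (iter_cauchy_le _ _ D1 a1 bD) _.
    rewrite lerXn2r ?nnegrE ?mulr_ge0// -mulrA ler_wpM2l// -natrM ler_nat.
    by rewrite mul2n -addnn addSnnS leq_addl.
  apply: le_trans (_ : N.+1%:R ^+ r * modulus mu ^+ N * (D * 2 * N.+1%:R) ^+ n <= _).
    apply: ler_pM => //; rewrite ?mulr_ge0 ?exprn_ge0 ?modulus_ge0//.
    by apply: ler_pM; rewrite ?exprn_ge0 ?modulus_ge0.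
  by rewrite le_eqVlt; apply/orP; left; apply/eqP; rewrite exprD exprMn; ring.
rewrite -[X in _ --> X](mulr0 ((D * 2) ^+ n)); apply: cvgMl_tmp.
by apply: cvg_poly_geometric; rewrite modulus_ge0.
Qed.

Lemma expands_iter f g a b m : expands f a -> expands g b ->
  expands (fun t => f t ^+ m * g t) (iter m (cauchy_product a) b).
Proof.
move=> fa gb; elim: m => [|m IH] /=.
  by apply: expands_eq gb _; apply: near0W => t; rewrite expr0 mul1r.
apply: expands_eq (expandsM fa IH) _.
by apply: near0W => t; rewrite exprS mulrA.
Qed.

Lemma expands_sum (F : nat -> C R -> C R) (B : nat -> nat -> C R) N :
  (forall m, expands (F m) (B m)) ->
  expands (fun t => \sum_(m < N) F m t) (fun n => \sum_(m < N) B m n).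
Proof.
move=> FB; elim: N => [|N IH].
  have := expands_cst (0 : C R).
  have -> : (fun n : nat => if n == 0%N then 0 else 0) = (fun n => \sum_(m < 0) B m n).
    by apply/funext => n; rewrite big_ord0 if_same.
  by move/expands_eq; apply; apply: near0W => t; rewrite big_ord0.
have -> : (fun n => \sum_(m < N.+1) B m n) = (fun n => \sum_(m < N) B m n + B N n).
  by apply/funext => n; rewrite big_ord_recr.
apply: expands_eq (expandsD IH (FB N)) _.
by apply: near0W => t; rewrite big_ord_recr.
Qed.

(** Induction on r through [binomial_partial_sum], divided by 1 - mu f and read
    on coefficients by uniqueness of expansions. *)
Lemma cvg_binomial_coef (D : R) f g a b mu (r : nat) : 1 <= D ->
  expands f a -> (forall n, modulus (a n) <= 1) ->
  expands g b -> (forall n, modulus (b n) <= D ^+ n) -> modulus mu < 1 ->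
  exists2 h, expands (fun t => (1 - mu * f t)^-1 ^+ r * g t) h &
    forall n, (fun N => \sum_(m < N.+1) binomial_weight r mu m *
      iter m (cauchy_product a) b n) @ \oo --> h n.
Proof.
move=> D1 fa a1 gb bD mu1.
have fd := expandsD (expands_cst 1) (expandsZ (- mu) fa).
have d0 : 1 + - mu * a 0%N != 0.
  (* |mu a_0| < 1 since |mu| < 1 and |a_0| <= 1. *)
  rewrite mulNr subr_eq0; apply: contraTneq (a1 0%N) => e.
  rewrite -ltNge; have : modulus mu * modulus (a 0%N) = 1.
    by rewrite -modulusM -e modulus1.
  have := modulus_ge0 mu; have := modulus_ge0 (a 0%N); nra.
have [fd0 [v fv]] := expandsV fd d0.
have {}fd0 : \forall t \near (0 : C R), 1 - mu * f t != 0.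
  by apply: near0S fd0 => t; rewrite mulNr.
have {}fv : expands (fun t => (1 - mu * f t)^-1) v.
  by apply: expands_eq fv _; apply: near0W => t; rewrite mulNr.
have Sexp r' N : expands
    (fun t => \sum_(m < N) binomial_weight r' mu m * (f t ^+ m * g t))
    (fun n => \sum_(m < N) binomial_weight r' mu m * iter m (cauchy_product a) b n).
  exact (expands_sum N (fun m =>
    expandsZ (binomial_weight r' mu m) (expands_iter m fa gb))).
elim: r => [|r [h fh ch]].
  exists b; first by apply: expands_eq gb _; apply: near0W => t; rewrite expr0 mul1r.
  move=> n; under eq_fun => N.
    rewrite big_ord_recl big1 ?addr0; last first.
      by move=> i _; rewrite /binomial_weight/= addn0 subn1/= bin_small ?mul0r.
    rewrite /binomial_weight bin0 expr0 !mul1r/=; over.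
  exact: cvg_cst.
exists (cauchy_product v h).
  apply: expands_eq (expandsM fv fh) _.
  by apply: near0W => t; rewrite exprS mulrA.
move=> n.
have step N : (fun n => \sum_(m < N.+1) binomial_weight r.+1 mu m *
      iter m (cauchy_product a) b n) =
    cauchy_product v (fun n => \sum_(m < N.+1) binomial_weight r mu m *
      iter m (cauchy_product a) b n +
      -1 * ('C(N + r, N)%:R * mu ^+ N.+1 * iter N.+1 (cauchy_product a) b n)).
  apply: (expands_coef (Sexp r.+1 N.+1)).
  have bexp := expandsZ (-1) (expandsZ ('C(N + r, N)%:R * mu ^+ N.+1)
    (expands_iter N.+1 fa gb)).
  apply: expands_eq (expandsM fv (expandsD (Sexp r N.+1) bexp)) _.
  apply: near0S fd0 => t ft0.
  by rewrite mulN1r -binomial_partial_sum mulKf.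
under eq_fun => N do rewrite (congr1 (@^~ n) (step N)).
apply: cvg_cauchy_product => k.
have := cvgD_complex (ch k) (@cvgZ_complex _ (-1) _ _ (cvg_boundary r k D1 a1 bD mu1)).
by rewrite mulr0 addr0.
Qed.
End NegativeBinomial.

(** * Mersenne expansions *)

Section Mersenne.
Variable R : realType.
Implicit Types (f : C R -> C R) (b : nat -> C R) (t x z lambda : C R).

Lemma mersenne_fact_gt0 n : (0 < mersenne_fact n)%N.
Proof.
rewrite /mersenne_fact big_seq; apply: prodn_cond_gt0 => k.
rewrite mem_index_iota => /andP[k0 _].
by rewrite subn_gt0 -[X in (X < _)%N](expn0 2) ltn_exp2l.
Qed.

Lemma mersenne_fact_neq0 n : (mersenne_fact n)%:R != 0 :> C R.
Proof. by rewrite pnatr_eq0 -lt0n mersenne_fact_gt0. Qed.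

Lemma mersenne_expansion_expands f (a : nat -> C R) :
  has_mersenne_expansion f a <-> expands f (fun n => a n / (mersenne_fact n)%:R).
Proof.
have e t : mersenne_term a t = (fun n => a n / (mersenne_fact n)%:R * t ^+ n).
  by apply/funext => n; rewrite /mersenne_term mulrAC.
by split; apply: near0S => t; rewrite /power_series e.
Qed.

(** Uniqueness of coefficients pins down the sequence that the choice operator
    selects. *)
Lemma mersenne_coef_expands f b n :
  expands f b -> mersenne_coef f n = (mersenne_fact n)%:R * b n.
Proof.
move=> fb.
have ex : has_mersenne_expansion f (fun n => (mersenne_fact n)%:R * b n).
  apply/mersenne_expansion_expands.
  have -> : (fun n => (mersenne_fact n)%:R * b n / (mersenne_fact n)%:R) = b.
    by apply/funext => k; rewrite mulrC mulKf// mersenne_fact_neq0.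
  exact fb.
have : has_mersenne_expansion f (mersenne_coef f).
  exact: (getPex (ex_intro (fun a => has_mersenne_expansion f a) _ ex)).
move=> /mersenne_expansion_expands fc.
have <- := congr1 (@^~ n) (expands_coef fc fb).
by rewrite /= mulrC divfK// mersenne_fact_neq0.
Qed.

Lemma mersenne_exp_coef_le z n :
  modulus (z ^+ n / (mersenne_fact n)%:R) <= modulus z ^+ n.
Proof.
rewrite modulusM modulusV modulusX modulus_nat ler_piMr ?exprn_ge0 ?modulus_ge0//.
by rewrite invf_le1 ?ltr0n ?ler1n mersenne_fact_gt0.
Qed.

Lemma expands_mersenne_exp z :
  expands (fun t => mersenne_exp (z * t)) (fun n => z ^+ n / (mersenne_fact n)%:R).
Proof.
have gb : geometric_bounded (fun n => z ^+ n / (mersenne_fact n)%:R).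
  exists 1, (1 + modulus z); split; first by rewrite ltr_pwDl ?modulus_ge0.
  move=> n; rewrite mul1r; apply: le_trans (mersenne_exp_coef_le _ _) _.
  by rewrite lerXn2r ?nnegrE ?addr_ge0 ?modulus_ge0// lerDr.
apply: expands_eq (bounded_expands gb) _; apply: near0W => t.
rewrite /mersenne_exp /power_series; congr (limn (series _)); apply/funext => n.
by rewrite /mersenne_term mul1r exprMn mulrAC.
Qed.
End Mersenne.

Lemma lerch_euler_expansion (R : realType) (r n : nat) (x lambda : C R) :
  modulus lambda < 1 ->
  series (lerch_euler_term r lambda n x) @ \oo -->
    (1 / 2 ^+ r * apostol_mersenne_euler r n x lambda : C R).
Proof.
move=> l1; set M := (mersenne_fact n)%:R : C R.
have fa : expands (@mersenne_exp (C R)) (fun n => 1 ^+ n / (mersenne_fact n)%:R).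
  apply: expands_eq (expands_mersenne_exp 1) _; apply: near0W => t.
  by rewrite mul1r.
have a1 k : modulus (1 ^+ k / (mersenne_fact k)%:R : C R) <= 1.
  by apply: le_trans (mersenne_exp_coef_le _ _) _; rewrite modulus1 expr1n.
have gb := expands_mersenne_exp x.
have bD k : modulus (x ^+ k / (mersenne_fact k)%:R) <= (1 + modulus x) ^+ k.
  apply: le_trans (mersenne_exp_coef_le _ _) _.
  by rewrite lerXn2r ?nnegrE ?addr_ge0 ?modulus_ge0// lerDr.
have D1 : 1 <= 1 + modulus x by rewrite lerDl modulus_ge0.
have ml1 : modulus (- lambda) < 1 by rewrite modulusN.
have [h fh ch] := cvg_binomial_coef r D1 fa a1 gb bD ml1.
have -> : 1 / 2 ^+ r * apostol_mersenne_euler r n x lambda = M * h n.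
  rewrite /apostol_mersenne_euler (mersenne_coef_expands (b := fun n => 2 ^+ r * h n)).
    by rewrite -/M mul1r mulrCA mulKf// expf_neq0// pnatr_eq0.
  apply: expands_eq (expandsZ (2 ^+ r) fh) _; apply: near0W => t.
  by rewrite mulNr opprK addrC exprMn mulrA.
rewrite -(cvg_shiftS (series _)).
have -> : (fun N => series (lerch_euler_term r lambda n x) N.+1) =
    (fun N => M * \sum_(m < N.+1) binomial_weight r (- lambda) m *
      iter m (cauchy_product (fun n => 1 ^+ n / (mersenne_fact n)%:R))
        (fun n => x ^+ n / (mersenne_fact n)%:R) n).
  apply/funext => N; rewrite /series/= big_mkord mulr_sumr.
  apply: eq_bigr => m _; rewrite /lerch_euler_term /mersenne_translation.
  rewrite (mersenne_coef_expands (b := iter m (cauchy_product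
    (fun n => 1 ^+ n / (mersenne_fact n)%:R))
    (fun n => x ^+ n / (mersenne_fact n)%:R))).
    by rewrite -/M /binomial_weight (exprNn lambda); ring.
  apply: expands_eq (expands_iter m fa gb) _; apply: near0W => t.
  by rewrite mulrC.
exact (cvgZ_complex (ch n)).
Qed.

Theorem theorem6p3 (R : realType) (r n : nat) (x lambda : R[i]^o) :
  (0 < r)%N -> `|lambda| < 1 ->
  cvgn (series (lerch_euler_term r lambda n x)) /\
  lerch_euler r lambda n x =
    1 / 2 ^+ r * apostol_mersenne_euler r n x lambda.
Proof.
move=> _ l1; have ml1 : modulus (lambda : C R) < 1 by rewrite -ltcR -modulusE.
have h := @lerch_euler_expansion R r n x lambda ml1.
split; first exact (cvgP _ h).
exact (cvg_lim (@norm_hausdorff _ _) h).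
Qed.
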